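(* Let $g$ be any simple graph on $n\ge 1$ vertices, and let $s_1\le\ldots\le s_n$ be its shell sequence sorted in non-decreasing order. Run on the input $s_1\le\ldots\le s_n$, the randomized procedure $\mathsf{GraphSampler}$ (defined in the context) outputs, with positive probability, a graph isomorphic to $g$.
   Context: All graphs are finite, simple and undirected. The $k$-core $H_k(g)$ of a graph $g$ is the maximal subgraph of $g$ in which every vertex has degree at least $k$ (possibly empty). A vertex $v$ has shell index $i$ if $v\in H_i(g)$ but $v\notin H_{i+1}(g)$. The shell sequence of a graph on vertices $v_1,\ldots,v_n$ is the vector whose $i$-th entry is the shell index of $v_i$. $\mathsf{GraphSampler}$. Input: an integer sequence $s_1\le\ldots\le s_n$ that is the sorted shell sequence of some simple graph. Output: a graph on the vertices $v_1,\ldots,v_n$. The graph starts with no edges, and integer counters are initialized $t_1=\ldots=t_n=0$. Phase 1. For $i=1,2,\ldots,n-s_n-1$ in order: choose a random subset $R\subseteq\{v_j: i<j\le n\}$ with $\max\{0,s_i-t_i\}\le |R|\le s_i$; for every $v_j\in R$, add the edge $v_iv_j$, and if $s_j=s_i$ increase $t_j$ by $1$. Phase 2. Set $S=\{v_j: n-s_n\le j\le n\}$. Go through the vertices $v_j$ of this set one by one; whenever $t_j=0$, remove $v_j$ from $S$ and then add edges from $v_j$ to all vertices $v_k$ currently in $S$. Phase 3. While $S\neq\emptyset$: pick any $v_i\in S$ and remove it from $S$; choose a random subset $R\subseteq S$ with $|R|\ge |S|-t_i$; for every $v_j\in R$ add the edge $v_iv_j$; then go one by one through the vertices $v_j$ of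 $S\setminus R$ (this set being determined right after $R$ is chosen), decreasing $t_j$ by $1$ and, if now $t_j=0$, removing $v_j$ from $S$ and adding edges from $v_j$ to all vertices $v_k$ currently in $S$. Every random choice of a subset $R$ is made (independently of the past, given the current state) so that each admissible subset has positive probability; the choice of $v_i\in S$ in Phase 3 is made by an arbitrary rule. *)

(* Defs.v *)
From mathcomp Require Import all_boot all_order all_algebra.
From mathcomp Require Import zify.

Set Implicit Arguments.
Unset Strict Implicit.
Unset Printing Implicit Defensive.

Import Order.TTheory GRing.Theory Num.Theory.
Local Open Scope ring_scope.

(** * Graphs, cores and shells *)

(* A graph on the vertex set [T] is given by its set of edges; every element
   of [T] is a vertex. *)
Definition simple_graph (T : finType) (E : {set {set T}}) : bool :=
  [forall e in E, #|e| == 2%N].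

Definition isomorphic (T U : finType) (E : {set {set T}}) (F : {set {set U}}) :
    bool :=
  [exists f : {ffun T -> U},
    [&& injectiveb f, [forall y, exists x, f x == y] &
        F == [set f @: (e : {set T}) | e in E]]].

(* A subgraph is a pair (set of vertices, set of edges). *)
Definition subgraph (T : finType) (E : {set {set T}})
    (H : {set T} * {set {set T}}) : bool :=
  (H.2 \subset E) && [forall e in H.2, e \subset H.1].

Definition degree (T : finType) (H : {set T} * {set {set T}}) (v : T) : nat :=
  #|[set e in H.2 | v \in e]|.

Definition min_degree (T : finType) (k : nat) (H : {set T} * {set {set T}}) :
    bool :=
  [forall v in H.1, (k <= degree H v)%N].

(* The maximal subgraph of minimum degree at least [k] is the union of all
   such subgraphs: see [core_subgraph], [core_min_degree], [core_maximal]. *)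
Definition core (T : finType) (E : {set {set T}}) (k : nat) :
    {set T} * {set {set T}} :=
  (\bigcup_(H | subgraph E H && min_degree k H) H.1,
   \bigcup_(H | subgraph E H && min_degree k H) H.2).

Lemma core_subgraph (T : finType) (E : {set {set T}}) (k : nat) :
  subgraph E (core E k).
Proof.
apply/andP; split.
  by apply/bigcupsP => H /andP[/andP[]].
apply/forall_inP => e /bigcupP[H PH eH].
have /andP[/andP[_ /forall_inP sH] _] := PH.
exact: subset_trans (sH e eH) (bigcup_sup H PH).
Qed.

Lemma core_maximal (T : finType) (E : {set {set T}}) (k : nat)
    (H : {set T} * {set {set T}}) :
  subgraph E H -> min_degree k H ->
  H.1 \subset (core E k).1 /\ H.2 \subset (core E k).2.
Proof.
move=> sH dH; have PH : subgraph E H && min_degree k H by rewrite sH.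
by split; apply: (bigcup_sup H PH).
Qed.

Lemma core_min_degree (T : finType) (E : {set {set T}}) (k : nat) :
  min_degree k (core E k).
Proof.
apply/forall_inP => v /bigcupP[H PH vH].
have /andP[sH dH] := PH; have [_ s2] := core_maximal sH dH.
apply: leq_trans (forall_inP dH v vH) _; apply: subset_leq_card.
by apply/subsetP => e; rewrite !inE => /andP[/(subsetP s2) -> ->].
Qed.

Definition has_shell_index (T : finType) (E : {set {set T}}) (v : T)
    (i : nat) : bool :=
  (v \in (core E i).1) && (v \notin (core E i.+1).1).

Lemma has_shell_index_exists (T : finType) (E : {set {set T}}) (v : T) :
  exists i, has_shell_index E v i.
Proof.
have v0 : v \in (core E 0).1.
  have sH : subgraph E (setT, set0).
    by apply/andP; split; [exact: sub0set | apply/forall_inP => e; rewrite inE].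
  have dH : min_degree 0 (setT : {set T}, set0 : {set {set T}}) by exact/forall_inP.
  by have [/subsetP s _] := core_maximal sH dH; exact/s/in_setT.
have bnd i : v \in (core E i).1 -> (i <= #|E|)%N.
  move=> vi; apply: leq_trans (forall_inP (core_min_degree E i) v vi) _.
  apply/subset_leq_card/subsetP => e; rewrite inE => /andP[eH _].
  by have /andP[/subsetP-> //] := core_subgraph E i.
have [m vm mx] := ex_maxnP (ex_intro _ 0%N v0) bnd.
exists m; rewrite /has_shell_index vm; apply/negP => /mx; lia.
Qed.

Definition shell_index (T : finType) (E : {set {set T}}) (v : T) : nat :=
  ex_minn (has_shell_index_exists E v).

Lemma shell_indexP (T : finType) (E : {set {set T}}) (v : T) (i : nat) :
  has_shell_index E v i = (i == shell_index E v).
Proof.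
have mono j k : (j <= k)%N -> v \in (core E k).1 -> v \in (core E j).1.
  move=> jk; have dH : min_degree j (core E k).
    apply/forall_inP => w wk; apply: leq_trans jk _.
    exact: forall_inP (core_min_degree E k) w wk.
  by have [/subsetP s _] := core_maximal (core_subgraph E k) dH; exact: s.
rewrite /shell_index; case: ex_minnP => m /andP[vm vm1] _.
apply/idP/eqP => [/andP[vi vi1]|->]; last by rewrite /has_shell_index vm.
case: (ltngtP i m) => // lt.
- by rewrite (mono _ _ lt vm) in vi1.
- by rewrite (mono _ _ lt vi) in vm1.
Qed.

Definition sorted_shell_sequence (T : finType) (E : {set {set T}}) : seq nat :=
  sort leq [seq shell_index E v | v <- enum T].

(** * Finitely supported distributions *)

(* A list of weighted outcomes; an outcome may occur several times, its
   probability being the sum of its weights. *)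
Definition dist (R : realFieldType) (A : Type) : Type := seq (R * A).

Definition ret (R : realFieldType) (A : Type) (a : A) : dist R A := [:: (1, a)].

Definition bind (R : realFieldType) (A B : Type) (d : dist R A)
    (f : A -> dist R B) : dist R B :=
  [seq (p.1 * q.1, q.2) | p <- d, q <- f p.2].

Notation "'let*' x ':=' d 'in' f" := (bind d (fun x => f))
  (at level 200, x name, d at level 200, f at level 200).

Definition sample (R : realFieldType) (U : finType) (A : {set U})
    (p : U -> R) : dist R U :=
  [seq (p x, x) | x <- enum A].

Definition prob (R : realFieldType) (A : Type) (P : pred A) (d : dist R A) : R :=
  \sum_(x <- d | P x.2) x.1.

Definition pmf_on (R : realFieldType) (U : finType) (A : {set U}) (p : U -> R) :
    Prop :=
  (forall x, x \in A -> 0 <= p x) /\ \sum_(x in A) p x = 1.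

Definition full_pmf_on (R : realFieldType) (U : finType) (A : {set U})
    (p : U -> R) : Prop :=
  pmf_on A p /\ forall x, x \in A -> 0 < p x.

(** * GraphSampler *)

(* The vertex [v_j] is the ordinal of value [j - 1]. *)
Record state (n : nat) := State {
  edges : {set {set 'I_n}};
  counter : {ffun 'I_n -> int};  (* [t] *)
  pool : {set 'I_n}              (* [S]; empty during the first phase *)
}.

Definition star (n : nat) (i : 'I_n) (X : {set 'I_n}) : {set {set 'I_n}} :=
  [set [set i; j] | j in X].

Definition connect_to (n : nat) (i : 'I_n) (X : {set 'I_n}) (st : state n) :
    state n :=
  State (edges st :|: star i X) (counter st) (pool st).

Definition remove (n : nat) (i : 'I_n) (st : state n) : state n :=
  State (edges st) (counter st) (pool st :\ i).

Definition decrement (n : nat) (j : 'I_n) (st : state n) : state n :=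
  State (edges st)
    [ffun k => if k == j then counter st k - 1 else counter st k] (pool st).

Definition flush_if_zero (n : nat) (j : 'I_n) (st : state n) : state n :=
  if counter st j == 0 then
    let st' := remove j st in connect_to j (pool st') st'
  else st.

Definition admissible1 (s : seq nat) (i : 'I_(size s)) (st : state (size s)) :
    {set {set 'I_(size s)}} :=
  [set X : {set 'I_(size s)} | (X \subset [set j : 'I_(size s) | (i < j)%N]) &&
    (Num.max 0 ((nth 0%N s i)%:Z - counter st i) <= #|X|%:Z
       <= (nth 0%N s i)%:Z)].

(* [st] is the state once [i] has been removed from [S]. *)
Definition admissible3 (n : nat) (i : 'I_n) (st : state n) : {set {set 'I_n}} :=
  [set X : {set 'I_n} | (X \subset pool st) &&
    (#|pool st|%:Z - counter st i <= #|X|%:Z)].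

(* What the procedure leaves open.  The laws of the random subsets depend on
   the current state only, whereas the rule choosing [v_i] in the third phase
   may be randomized (a deterministic rule is a Dirac mass) and may depend on
   all earlier iterations, recorded as (state, chosen vertex, chosen subset).
   [visit] gives the order in which a set of vertices is gone through.  Laws
   are constrained only where there is something to choose, so that [choices]
   is inhabited for every [s]. *)
Record choices (R : realFieldType) (s : seq nat) := Choices {
  law1 : 'I_(size s) -> state (size s) -> {set 'I_(size s)} -> R;
  law3 : 'I_(size s) -> state (size s) -> {set 'I_(size s)} -> R;
  rule : seq (state (size s) * 'I_(size s) * {set 'I_(size s)}) ->
         state (size s) -> 'I_(size s) -> R;
  visit : state (size s) -> {set 'I_(size s)} -> seq 'I_(size s);
  law1P : forall i st, admissible1 i st != set0 ->
    full_pmf_on (admissible1 i st) (law1 i st);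
  law3P : forall i st, admissible3 i st != set0 ->
    full_pmf_on (admissible3 i st) (law3 i st);
  ruleP : forall past st, pool st != set0 -> pmf_on (pool st) (rule past st);
  visitP : forall st A, perm_eq (visit st A) (enum A)
}.

Definition step1 (s : seq nat) (i : 'I_(size s)) (X : {set 'I_(size s)})
    (st : state (size s)) : state (size s) :=
  State (edges st :|: star i X)
    [ffun j => if (j \in X) && (nth 0%N s j == nth 0%N s i)
               then counter st j + 1 else counter st j]
    (pool st).

Fixpoint phase1 (R : realFieldType) (s : seq nat) (c : choices R s)
    (l : seq 'I_(size s)) (st : state (size s)) : dist R (state (size s)) :=
  if l is i :: l' then
    let* X := sample (admissible1 i st) (law1 c i st) in
    phase1 c l' (step1 i X st)
  else ret R st.

Definition phase2 (R : realFieldType) (s : seq nat) (c : choices R s)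
    (st : state (size s)) : state (size s) :=
  let st0 := State (edges st) (counter st)
    [set j : 'I_(size s) | (size s - last 0 s <= j.+1)%N] in
  foldl (fun st' j => flush_if_zero j st') st0 (visit c st0 (pool st0)).

Definition step3 (R : realFieldType) (s : seq nat) (c : choices R s)
    (i : 'I_(size s)) (X : {set 'I_(size s)}) (st : state (size s)) :
    state (size s) :=
  let st0 := connect_to i X st in
  foldl (fun st' j => flush_if_zero j (decrement j st')) st0
    (visit c st0 (pool st0 :\: X)).

(* Each iteration shrinks [S], so the bound [m = #|S|] on the number of
   iterations is never exhausted; were it so, there would be no output. *)
Fixpoint phase3 (R : realFieldType) (s : seq nat) (c : choices R s) (m : nat)
    (past : seq (state (size s) * 'I_(size s) * {set 'I_(size s)}))
    (st : state (size s)) : dist R {set {set 'I_(size s)}} :=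
  if pool st == set0 then ret R (edges st)
  else if m is m'.+1 then
    let* i := sample (pool st) (rule c past st) in
    let st' := remove i st in
    let* X := sample (admissible3 i st') (law3 c i st') in
    phase3 c m' ((st, i, X) :: past) (step3 c i X st')
  else [::].

Definition graph_sampler (R : realFieldType) (s : seq nat) (c : choices R s) :
    dist R {set {set 'I_(size s)}} :=
  let* st1 := phase1 c
    [seq i : 'I_(size s) <- enum 'I_(size s) | (i.+1 <= size s - last 0 s - 1)%N]
    (State set0 [ffun=> 0] set0) in
  let st2 := phase2 c st1 in
  phase3 c #|pool st2| [::] st2.

(* Main.v *)
Require Import Defs.
From mathcomp Require Import all_boot all_order all_algebra.
From mathcomp Require Import zify.

Set Implicit Arguments.
Unset Strict Implicit.
Unset Printing Implicit Defensive.

Import Order.TTheory GRing.Theory Num.Theory.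
Local Open Scope ring_scope.

(** Some run of the procedure builds a relabelled copy of the graph exactly.

    The relabelling lists the vertices by non-decreasing shell index, so that
    each vertex [v] has at most [shell v] neighbours after it
    ([ex_peeling_order]).  Such an order exists because every nonempty set [A]
    of vertices contains a [v] of least shell index [k] with at most [k]
    neighbours in [A]: otherwise the subgraph induced on the union of [A] and
    the [(k+1)]-core would have minimum degree at least [k+1], and [A] would
    lie inside the [(k+1)]-core ([ex_peelable]).

    Let [F] be the relabelled edge set.  The intended run always takes for [R]
    the set of [F]-neighbours of [v_i] among the candidates.  A vertex of shell
    index [k] has at least [k] neighbours of shell index at least [k]
    ([shell_le_card_nbr]).  In the first phase such neighbours of [v_i] either
    come later, and so belong to [R], or come earlier with the same shell index
    and are counted by [t_i]; hence [R] is admissible ([phase1_bind_gt0]).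

    The set [S] of the second phase consists of [d+1] vertices of the largest
    shell index [d], so the same count shows that for [j] in [S] the counter
    [t_j] is at least the number of non-neighbours of [j] in [S].  This, along
    with the fact that the edges drawn so far are those edges of [F] that are
    not contained in [S], is the invariant [on_track].  It makes the intended
    [R] admissible in the third phase, whichever vertex is picked, and it shows
    that a vertex whose counter reaches [0] is adjacent to all of [S], so that
    flushing it draws edges of [F] only ([flush_on_track]).  When [S] is empty,
    the edges drawn are exactly [F] ([phase3_gt0]). *)

(** * Neighbourhoods *)

(** The neighbours of [v] in [A]. *)
Definition nbr (T : finType) (E : {set {set T}}) (v : T) (A : {set T}) :
    {set T} :=
  [set w in A | [set v; w] \in E].

(** The vertices of [A] other than [v] that are not adjacent to [v]. *)
Definition non_nbr (T : finType) (E : {set {set T}}) (v : T) (A : {set T}) :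
    {set T} :=
  [set w in A | (w != v) && ([set v; w] \notin E)].

(** The edges with at least one end outside [S]: those that have been drawn
    once [S] is the set of vertices still to be processed. *)
Definition edges_not_in (T : finType) (E : {set {set T}}) (S : {set T}) :
    {set {set T}} :=
  [set e in E | ~~ (e \subset S)].

Lemma edge_neq (T : finType) (E : {set {set T}}) (v w : T) :
  simple_graph E -> [set v; w] \in E -> w != v.
Proof.
move=> /forall_inP sE /sE; apply: contraTneq => ->.
by rewrite setUid cards1.
Qed.

Lemma edge_other (T : finType) (E : {set {set T}}) (e : {set T}) (v : T) :
  simple_graph E -> e \in E -> v \in e -> exists2 w, w != v & e = [set v; w].
Proof.
move=> /forall_inP sE /sE /cards2P[x [y [xy ->]]].
rewrite !inE => /orP[] /eqP ->; first by exists y; rewrite // eq_sym.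
by exists x => //; rewrite setUC.
Qed.

Lemma pair_inj (T : finType) (v w w' : T) :
  w != v -> [set v; w] = [set v; w'] -> w = w'.
Proof.
move=> wv /setP/(_ w); rewrite !inE eqxx orbT (negbTE wv) /=.
by move=> /esym/eqP.
Qed.

Lemma nbrS (T : finType) (E : {set {set T}}) (v : T) (A B : {set T}) :
  A \subset B -> nbr E v A \subset nbr E v B.
Proof.
move=> /subsetP sAB; apply/subsetP => w; rewrite !inE => /andP[/sAB -> ->] //.
Qed.

Lemma non_nbrS (T : finType) (E : {set {set T}}) (v : T) (A B : {set T}) :
  A \subset B -> non_nbr E v A \subset non_nbr E v B.
Proof.
move=> /subsetP sAB; apply/subsetP => w; rewrite !inE => /andP[/sAB -> ->] //.
Qed.

(** Degrees are defined by counting edges, whereas the procedure samples sets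
    of vertices; this lemma and the next one translate between the two. *)
Lemma edges_at_nbr (T : finType) (E : {set {set T}}) (v : T) (A : {set T}) :
  simple_graph E -> v \in A ->
  [set e in E | (v \in e) && (e \subset A)] = [set [set v; w] | w in nbr E v A].
Proof.
move=> sE vA; apply/setP => e; rewrite inE; apply/and3P/imsetP.
  move=> [eE ve eA]; have [w wv def_e] := edge_other sE eE ve.
  exists w => //; rewrite inE -def_e eE andbT (subsetP eA) // def_e.
  by rewrite !inE eqxx orbT.
move=> [w]; rewrite inE => /andP[wA vwE] ->; split=> //.
  by rewrite !inE eqxx.
by apply/subsetP => x; rewrite !inE => /orP[] /eqP ->.
Qed.

Lemma card_edges_at (T : finType) (E : {set {set T}}) (v : T) (A : {set T}) :
  simple_graph E -> v \in A ->
  #|[set e in E | (v \in e) && (e \subset A)]| = #|nbr E v A|.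
Proof.
move=> sE vA; rewrite edges_at_nbr // card_in_imset // => w w'.
by rewrite inE => /andP[_ /(edge_neq sE) wv] _; apply: pair_inj.
Qed.

(** Processing a vertex [i] of [S] amounts to drawing the edges from [i] to its
    neighbours in [S]. *)
Lemma edges_not_in_remove (n : nat) (F : {set {set 'I_n}}) (i : 'I_n)
    (S : {set 'I_n}) :
  simple_graph F -> i \in S ->
  edges_not_in F S :|: star i (nbr F i S) = edges_not_in F (S :\ i).
Proof.
move=> sF iS; rewrite /star -edges_at_nbr //; apply/setP => e.
by rewrite !inE subsetD1; case: (e \in F); case: (i \in e); case: (e \subset S).
Qed.

Lemma edges_not_in_set0 (T : finType) (E : {set {set T}}) :
  simple_graph E -> edges_not_in E set0 = E.
Proof.
move=> sE; apply/setP => e; rewrite inE subset0 andb_idr // => /(forall_inP sE).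
by apply: contraTneq => ->; rewrite cards0.
Qed.

Lemma edges_not_in_setT (T : finType) (E : {set {set T}}) :
  edges_not_in E setT = set0.
Proof. by apply/setP => e; rewrite !inE subsetT andbF. Qed.

Lemma card_nbr_non_nbr (T : finType) (E : {set {set T}}) (v : T) (A : {set T}) :
  simple_graph E -> v \in A -> #|A| = (#|nbr E v A| + #|non_nbr E v A|).+1.
Proof.
move=> sE vA; rewrite (cardsD1 v) vA -cardsUI.
have -> : nbr E v A :&: non_nbr E v A = set0.
  by apply/setP => w; rewrite !inE; case: (_ \in E); rewrite ?andbF.
rewrite cards0 addn0; congr _.+1; apply: eq_card => w; rewrite !inE.
case: (w \in A); rewrite ?andbF //=.
by case: (boolP (_ \in E)) => [/(edge_neq sE)->|_]; rewrite ?andbT.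
Qed.

(** * Positive probability *)

Lemma prob_bind (R : realFieldType) (A B : Type) (P : pred B) (d : dist R A)
    (f : A -> dist R B) :
  prob P (bind d f) = \sum_(p <- d) p.1 * prob P (f p.2).
Proof.
rewrite /prob /bind big_mkcond big_allpairs_dep /=; apply: eq_bigr => p _.
by rewrite -big_mkcond big_distrr.
Qed.

Lemma prob_bind_sample (R : realFieldType) (U : finType) (B : Type) (P : pred B)
    (A : {set U}) (p : U -> R) (f : U -> dist R B) :
  prob P (bind (sample A p) f) = \sum_(x in A) p x * prob P (f x).
Proof. by rewrite prob_bind /sample big_map big_enum. Qed.

Lemma prob_bind_ret (R : realFieldType) (A B : Type) (P : pred B) (a : A)
    (f : A -> dist R B) :
  prob P (bind (ret R a) f) = prob P (f a).
Proof. by rewrite prob_bind big_seq1 mul1r. Qed.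

Lemma prob_bind_bind (R : realFieldType) (A B C : Type) (P : pred C)
    (d : dist R A) (f : A -> dist R B) (g : B -> dist R C) :
  prob P (bind (bind d f) g) = prob P (bind d (fun x => bind (f x) g)).
Proof.
rewrite !prob_bind /bind big_allpairs_dep /=; apply: eq_bigr => p _.
rewrite prob_bind big_distrr /=; apply: eq_bigr => q _.
by rewrite mulrA.
Qed.

Lemma prob_bind_sample_ge0 (R : realFieldType) (U : finType) (B : Type)
    (P : pred B) (A : {set U}) (p : U -> R) (f : U -> dist R B) :
  (A != set0 -> pmf_on A p) -> (forall x, 0 <= prob P (f x)) ->
  0 <= prob P (bind (sample A p) f).
Proof.
move=> hp hf; rewrite prob_bind_sample; apply: sumr_ge0 => x xA.
have [|p0 _] := hp; first by apply/set0Pn; exists x.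
by rewrite mulr_ge0 ?p0.
Qed.

Lemma prob_bind_sample_gt0 (R : realFieldType) (U : finType) (B : Type)
    (P : pred B) (A : {set U}) (p : U -> R) (f : U -> dist R B) (x : U) :
  (A != set0 -> full_pmf_on A p) -> (forall x, 0 <= prob P (f x)) ->
  x \in A -> 0 < prob P (f x) -> 0 < prob P (bind (sample A p) f).
Proof.
move=> hp hf xA fx; have [|[p0 _] pp] := hp; first by apply/set0Pn; exists x.
rewrite prob_bind_sample (bigD1 x) //= ltr_pwDl ?mulr_gt0 ?pp //.
by apply: sumr_ge0 => y /andP[yA _]; rewrite mulr_ge0 ?p0.
Qed.

Lemma prob_bind_sample_all_gt0 (R : realFieldType) (U : finType) (B : Type)
    (P : pred B) (A : {set U}) (p : U -> R) (f : U -> dist R B) :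
  pmf_on A p -> (forall x, x \in A -> 0 < prob P (f x)) ->
  0 < prob P (bind (sample A p) f).
Proof.
move=> [p0 p1] hf; rewrite prob_bind_sample.
have h x : x \in A -> 0 <= p x * prob P (f x).
  by move=> xA; rewrite mulr_ge0 ?p0 // ltW ?hf.
rewrite lt_neqAle sumr_ge0 // andbT eq_sym; apply/eqP => /(psumr_eq0P h) z.
have := oner_neq0 R; rewrite -p1 big1 ?eqxx // => x xA.
by have /eqP := z x xA; rewrite mulf_eq0 (gt_eqF (hf x xA)) orbF => /eqP.
Qed.

(** * The second and third phases *)

(** The invariant of the second and third phases: the edges drawn are those of
    [F] that are not contained in the pool, and the counter of each vertex of
    the pool is at least the number of its non-neighbours there.  The vertices
    satisfying [D] are those still to be decremented in the current iteration
    of the third phase; for them the inequality holds with one to spare. *)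
Definition on_track (n : nat) (F : {set {set 'I_n}}) (D : pred 'I_n)
    (st : state n) : Prop :=
  edges st = edges_not_in F (pool st) /\
  forall j, j \in pool st ->
    (#|non_nbr F j (pool st)| + D j)%:Z <= counter st j.

(** Each vertex of the pool that is not adjacent to [i] loses one non-neighbour
    when [i] leaves: this is what pays for its decrement. *)
Lemma on_track_remove (n : nat) (F : {set {set 'I_n}}) (i : 'I_n)
    (X : {set 'I_n}) (st : state n) :
  simple_graph F -> on_track F pred0 st -> i \in pool st ->
  X = nbr F i (pool st) ->
  on_track F (mem (pool st :\ i :\: X)) (connect_to i X (remove i st)).
Proof.
move=> sF [eE cE] iS ->; split=> /=; first by rewrite eE edges_not_in_remove.
move=> j; rewrite !inE => /andP[ji jS].
apply: le_trans (cE j jS); rewrite lez_nat addn0 ji jS /= andbT.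
set S := pool st.
rewrite (cardsD1 i (non_nbr F j S)) addnC leq_add //.
  by rewrite /non_nbr !inE eq_sym ji iS /= (setUC [set j]).
apply: subset_leq_card; apply/subsetP => k; rewrite !inE.
by move=> /and3P[/andP[-> ->] -> ->].
Qed.

Lemma flush_on_track (n : nat) (F : {set {set 'I_n}}) (j : 'I_n)
    (D : pred 'I_n) (st : state n) :
  simple_graph F -> on_track F D st -> j \in pool st ->
  [/\ on_track F D (flush_if_zero j st),
      pool (flush_if_zero j st) \subset pool st &
      pool st :\ j \subset pool (flush_if_zero j st)].
Proof.
move=> sF [eE cE] jS; rewrite /flush_if_zero.
case: eqP => [c0|_]; last by split; rewrite ?subsetDl.
split; rewrite /= ?subsetDl //; split=> /=.
  (* A zero counter leaves no room for a non-neighbour of j in the pool. *)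
  have def_nbr : nbr F j (pool st) = pool st :\ j.
    have := cE j jS; rewrite c0 lez_nat leqn0 addn_eq0 cards_eq0.
    move=> /andP[/eqP/setP z _]; apply/setP => k; have := z k; rewrite !inE.
    have [->|kj] := eqVneq k j.
      by move=> _; apply/andP => -[_ /(edge_neq sF)]; rewrite eqxx.
    by case: (k \in pool st) => //= /negbFE.
  by rewrite eE -edges_not_in_remove // def_nbr.
move=> k /setD1P[kj kS]; apply: le_trans (cE k kS).
rewrite lez_nat leq_add2r; apply: subset_leq_card.
exact/non_nbrS/subsetDl.
Qed.

Lemma phase2_loop_on_track (n : nat) (F : {set {set 'I_n}}) (l : seq 'I_n)
    (st : state n) :
  simple_graph F -> uniq l -> {subset l <= pool st} -> on_track F pred0 st ->
  on_track F pred0 (foldl (fun st' j => flush_if_zero j st') st l).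
Proof.
move=> sF; elim: l st => //= j l IH st /andP[jl ul] sl tr.
have [|tr' _ /subsetP sub'] := flush_on_track sF tr (j := j).
  by apply: sl; rewrite mem_head.
apply: IH => // k kl; apply: sub'; rewrite !inE sl ?inE ?kl ?orbT //.
by rewrite andbT; apply: contraNneq jl => <-.
Qed.

Lemma phase3_loop_on_track (n : nat) (F : {set {set 'I_n}}) (l : seq 'I_n)
    (st : state n) :
  simple_graph F -> uniq l -> {subset l <= pool st} -> on_track F (mem l) st ->
  let st' := foldl (fun st' j => flush_if_zero j (decrement j st')) st l in
  on_track F pred0 st' /\ pool st' \subset pool st.
Proof.
move=> sF; elim: l st => [|j l IH] st /=.
  by move=> _ _ [eE cE]; split=> //; split.
move=> /andP[jl ul] sl [eE cE].
have tr : on_track F (mem l) (decrement j st).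
  split=> //= k kS; rewrite ffunE; have := cE k kS; rewrite /= inE.
  by have [->|_] := eqVneq k j; rewrite ?(negbTE jl) //=; lia.
have [|tr' sub /subsetP sub'] := flush_on_track sF tr (j := j).
  by apply: sl; rewrite mem_head.
have [|||tr'' sub''] := IH (flush_if_zero j (decrement j st)) => //.
  move=> k kl; apply: sub'; rewrite !inE /= sl ?inE ?kl ?orbT //.
  by rewrite andbT; apply: contraNneq jl => <-.
by split=> //; apply: subset_trans sub'' sub.
Qed.

Lemma phase3_ge0 (R : realFieldType) (s : seq nat) (c : choices R s)
    (P : pred {set {set 'I_(size s)}}) (m : nat)
    (past : seq (state (size s) * 'I_(size s) * {set 'I_(size s)}))
    (st : state (size s)) :
  0 <= prob P (phase3 c m past st).
Proof.
elim: m past st => [|m IH] past st /=; case: ifPn => [_|nz].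
- by rewrite /prob big_mkcond big_seq1; case: ifP.
- by rewrite /prob big_nil.
- by rewrite /prob big_mkcond big_seq1; case: ifP.
apply: prob_bind_sample_ge0 => [_|i]; first exact: ruleP.
by apply: prob_bind_sample_ge0 => [/(law3P c)[]|].
Qed.

(** From a state satisfying the invariant, the third phase outputs [F] with
    positive probability, for every rule choosing the vertex [v_i]. *)
Lemma phase3_gt0 (R : realFieldType) (s : seq nat) (c : choices R s)
    (F : {set {set 'I_(size s)}}) (P : pred {set {set 'I_(size s)}}) (m : nat)
    (past : seq (state (size s) * 'I_(size s) * {set 'I_(size s)}))
    (st : state (size s)) :
  simple_graph F -> P F -> on_track F pred0 st -> (#|pool st| <= m)%N ->
  0 < prob P (phase3 c m past st).
Proof.
move=> sF PF; elim: m past st => [|m IH] past st tr le_m.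
  have ps0 : pool st = set0 by apply/eqP; rewrite -cards_eq0 -leqn0.
  have [eE _] := tr; rewrite /= ps0 eqxx /prob big_mkcond big_seq1 /= eE ps0.
  by rewrite edges_not_in_set0 // PF.
rewrite /=; case: ifPn => [/eqP ps0|nz].
  have [eE _] := tr; rewrite /prob big_mkcond big_seq1 /= eE ps0.
  by rewrite edges_not_in_set0 // PF.
apply: prob_bind_sample_all_gt0 => [|i iS]; first exact: ruleP.
set st' := remove i st; set X := nbr F i (pool st).
apply: (@prob_bind_sample_gt0 _ _ _ _ _ _ _ X) => [||| ].
- exact: law3P.
- by move=> Y; apply: phase3_ge0.
- rewrite inE /=; apply/andP; split.
    apply/subsetP => k; rewrite !inE => /andP[-> kE].
    by rewrite (edge_neq sF kE).
  have [_ /(_ i iS)] := tr.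
  have := card_nbr_non_nbr sF iS; rewrite (cardsD1 i) iS addn0 -/X /=.
  have le_sub (a b w : nat) (z : int) :
    (true + a)%N = (b + w).+1 -> w%:Z <= z -> a%:Z - z <= b%:Z by lia.
  exact: le_sub.
have [|||tr' sub] := @phase3_loop_on_track _ F
  (visit c (connect_to i X st') (pool st' :\: X)) (connect_to i X st') sF.
- by rewrite (perm_uniq (visitP c _ _)) enum_uniq.
- by move=> k; rewrite (perm_mem (visitP c _ _)) mem_enum => /setDP[].
- have [e0 c0] := on_track_remove sF tr iS (erefl X).
  split=> // k /c0; rewrite /= (perm_mem (visitP c _ _)) mem_enum //.
apply: IH => //; apply: leq_trans (subset_leq_card sub) _ => /=.
by move: le_m; rewrite (cardsD1 i) iS.
Qed.

(** * The first phase *)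

(** The state reached when the first [m] vertices have drawn their edges of [F]
    to later vertices: the counter of [j] is the number of its neighbours of the
    same value in [s] that precede both [j] and position [m]. *)
Definition phase1_state (s : seq nat) (F : {set {set 'I_(size s)}}) (m : nat) :
    state (size s) :=
  State (edges_not_in F [set j : 'I_(size s) | (m <= j)%N])
    [ffun j : 'I_(size s) => #|[set k : 'I_(size s) | [&& (k < m)%N, (k < j)%N,
       [set k; j] \in F & nth 0%N s j == nth 0%N s k]]|%:Z]
    set0.

Lemma phase1_state0 (s : seq nat) (F : {set {set 'I_(size s)}}) :
  phase1_state F 0 = State set0 [ffun=> 0] set0.
Proof.
congr State.
  by rewrite -[RHS](edges_not_in_setT F); congr edges_not_in.
apply/ffunP => j; rewrite !ffunE.
by apply/eqP; rewrite eqz_nat cards_eq0; apply/eqP/setP => k; rewrite !inE.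
Qed.

Lemma step1_phase1_state (s : seq nat) (F : {set {set 'I_(size s)}})
    (i : 'I_(size s)) :
  simple_graph F ->
  step1 i (nbr F i [set j : 'I_(size s) | (i < j)%N]) (phase1_state F i) =
  phase1_state F i.+1.
Proof.
move=> sF; rewrite /step1 /phase1_state /=; congr State.
  have iS : i \in [set j : 'I_(size s) | (i <= j)%N] by rewrite inE.
  have -> : [set j : 'I_(size s) | (i < j)%N] =
            [set j : 'I_(size s) | (i <= j)%N] :\ i.
    by apply/setP => j; rewrite !inE -val_eqE /=; lia.
  rewrite -edges_not_in_remove //; congr (_ :|: star _ _); apply/setP => j.
  rewrite !inE; case: (boolP (_ \in F)) => [/(edge_neq sF)->//|_].
  by rewrite !andbF.
apply/ffunP => j; rewrite !ffunE !inE.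
set A := [set k | _]; set B := [set k : 'I__ | _].
have -> : B = if [&& (i < j)%N, [set i; j] \in F & nth 0%N s j == nth 0%N s i]
              then i |: A else A.
  apply/setP => k; case: ifP => h; rewrite !inE; last first.
    have [->|ki] := eqVneq k i; first by rewrite ltnSn h ltnn.
    by have -> : (k < i.+1)%N = (k < i)%N by move: ki; rewrite -val_eqE /=; lia.
  have [->|ki] := eqVneq k i; first by rewrite ltnSn h.
  by have -> : (k < i.+1)%N = (k < i)%N by move: ki; rewrite -val_eqE /=; lia.
rewrite -andbA; case: ifP => // _.
by rewrite cardsU1 !inE ltnn /= addrC -PoszD.
Qed.

Lemma sorted_nth_leq (s : seq nat) (i j : nat) :
  sorted leq s -> (i <= j)%N -> (j < size s)%N -> (nth 0 s i <= nth 0 s j)%N.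
Proof.
move=> ss ij js; apply: (sorted_leq_nth leq_trans leqnn) => //.
by rewrite inE (leq_ltn_trans ij).
Qed.

Lemma phase1_bind_ge0 (R : realFieldType) (s : seq nat) (c : choices R s)
    (B : Type) (P : pred B) (k : state (size s) -> dist R B)
    (l : seq 'I_(size s)) (st : state (size s)) :
  (forall st, 0 <= prob P (k st)) -> 0 <= prob P (bind (phase1 c l st) k).
Proof.
move=> k0; elim: l st => [|i l IH] st /=; first by rewrite prob_bind_ret.
rewrite prob_bind_bind; apply: prob_bind_sample_ge0 => [/(law1P c)[]|] //.
Qed.

(** The first phase followed by [k]: the intended run reaches
    [phase1_state F (m + size l)]. *)
Lemma phase1_bind_gt0 (R : realFieldType) (s : seq nat) (c : choices R s)
    (F : {set {set 'I_(size s)}}) (B : Type) (P : pred B)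
    (k : state (size s) -> dist R B) (l : seq 'I_(size s)) (m : nat) :
  simple_graph F -> sorted leq s ->
  (forall i : 'I_(size s),
    #|nbr F i [set j : 'I_(size s) | (i < j)%N]| <= nth 0 s i)%N ->
  (forall i : 'I_(size s),
    nth 0 s i <=
      #|nbr F i [set j : 'I_(size s) | (nth 0 s i <= nth 0 s j)%N]|)%N ->
  (forall st, 0 <= prob P (k st)) ->
  map val l = iota m (size l) ->
  0 < prob P (k (phase1_state F (m + size l))) ->
  0 < prob P (bind (phase1 c l (phase1_state F m)) k).
Proof.
move=> sF ss ub lb k0; elim: l m => [|i l IH] m /=.
  by rewrite addn0 prob_bind_ret.
move=> [im ml] kp; rewrite prob_bind_bind -im.
set X := nbr F i [set j : 'I_(size s) | (i < j)%N].
apply: (@prob_bind_sample_gt0 _ _ _ _ _ _ _ X) => [||| ].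
- exact: law1P.
- by move=> Y; apply: phase1_bind_ge0.
- rewrite inE; apply/andP; split.
    by apply/subsetP => j; rewrite inE => /andP[].
  apply/andP; split; last exact: ub.
  rewrite ge_max; apply/andP; split; first by [].
  rewrite /= ffunE; set C := [set _ | _].
  (* As s is sorted, an earlier vertex of value at least s_i has value s_i. *)
  have sub : nbr F i [set j : 'I_(size s) | (nth 0 s i <= nth 0 s j)%N]
      \subset X :|: C.
    apply/subsetP => j; rewrite !inE => /andP[sij ijF]; rewrite ijF andbT.
    have ji := edge_neq sF ijF; rewrite setUC ijF /=.
    case: (ltngtP i j) => //= [lt|/val_inj e].
      by rewrite eqn_leq sij sorted_nth_leq // ltnW.
    by rewrite e eqxx in ji.
  rewrite lerBlDr -PoszD lez_nat.
  exact: leq_trans (lb i) (leq_trans (subset_leq_card sub) (leq_card_setU X C)).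
rewrite step1_phase1_state //; apply: IH; first by rewrite im.
by rewrite im addSnnS.
Qed.

(** * The whole procedure *)

Lemma card_ord_geq (n m : nat) : (#|[set j : 'I_n | (m <= j)%N]| <= n - m)%N.
Proof.
rewrite cardE -(size_map val) -[leqRHS](size_iota m).
apply: uniq_leq_size.
  by rewrite map_inj_uniq ?enum_uniq //; exact: val_inj.
move=> k /mapP[j]; rewrite mem_enum inE mem_iota => mj ->.
by have := ltn_ord j; move: mj => /=; lia.
Qed.

(** The conditions on a labelled graph [F] and a sorted sequence [s] under which
    the procedure, run on [s], produces [F] itself with positive probability. *)
Lemma sampler_gt0 (R : realFieldType) (s : seq nat) (c : choices R s)
    (F : {set {set 'I_(size s)}}) (P : pred {set {set 'I_(size s)}}) :
  simple_graph F -> P F -> sorted leq s ->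
  (forall i : 'I_(size s),
    #|nbr F i [set j : 'I_(size s) | (i < j)%N]| <= nth 0 s i)%N ->
  (forall i : 'I_(size s),
    nth 0 s i <=
      #|nbr F i [set j : 'I_(size s) | (nth 0 s i <= nth 0 s j)%N]|)%N ->
  0 < prob P (graph_sampler c).
Proof.
move=> sF PF ss ub lb; rewrite /graph_sampler -(phase1_state0 F).
set n := size s; set d := last 0%N s; set M := (n - d - 1)%N.
set l := [seq i <- _ | _].
have val_l : map val l = iota 0 M.
  rewrite /l; have := @filter_map _ _ val (fun i => i < M)%N (enum 'I_n).
  rewrite val_enum_ord => e.
  rewrite [LHS](_ : _ = [seq i <- iota 0 n | (i < M)%N]); last by rewrite e.
  have -> : n = (M + (n - M))%N by rewrite /M; lia.
  rewrite iotaD filter_cat add0n.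
  rewrite (_ : filter _ (iota 0 M) = iota 0 M); last first.
    by apply/all_filterP/allP => j; rewrite mem_iota.
  rewrite (_ : filter _ (iota M _) = [::]) ?cats0 //.
  by apply/eqP; rewrite -[_ == _]negbK -has_filter; apply/hasPn => j;
    rewrite mem_iota; lia.
have size_l : size l = M by rewrite -(size_map val) val_l size_iota.
apply: phase1_bind_gt0 => //.
- by move=> st; apply: phase3_ge0.
- by rewrite val_l size_l.
rewrite add0n size_l; apply: (phase3_gt0 _ _ sF PF _ (leqnn _)).
pose Q := [set j : 'I_n | (n - d <= j.+1)%N].
rewrite /phase2 -/n -/d -/Q; set st0 := State _ _ Q.
have def_Q : [set j : 'I_n | (M <= j)%N] = Q.
  by apply/setP => j; rewrite !inE /M; lia.
apply: phase2_loop_on_track => //.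
- by rewrite (perm_uniq (visitP c _ _)) enum_uniq.
- by move=> k; rewrite (perm_mem (visitP c _ _)) mem_enum.
split=> /=; first by congr edges_not_in.
have cQ : (#|Q| <= d.+1)%N.
  by rewrite -def_Q; apply: leq_trans (card_ord_geq _ _) _; rewrite /M; lia.
have last_s (j : 'I_n) : (nth 0 s j <= d)%N.
  rewrite /d -nth_last sorted_nth_leq //; have := ltn_ord j; rewrite -/n; lia.
(* The last vertex and its at least d neighbours of value d make up at least
   d + 1 vertices of value d, and these come last since s is sorted. *)
have sQ (j : 'I_n) : j \in Q -> nth 0%N s j = d.
  move=> jQ; apply/eqP; rewrite eqn_leq last_s leqNgt; apply/negP => ltd.
  have n0 : (n.-1 < n)%N by have := ltn_ord j; lia.
  pose i := Ordinal n0; have := lb i.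
  have -> : nth 0%N s i = d by rewrite /d -nth_last.
  set N := nbr _ _ _ => dN.
  have iN : i \notin N.
    by rewrite inE; apply/andP => -[_ /(edge_neq sF)]; rewrite eqxx.
  have sub : i |: N \subset [set k : 'I_n | (j.+1 <= k)%N].
    apply/subsetP => k kN; rewrite inE ltnNge; apply/negP => kj.
    have : (d <= nth 0 s k)%N.
      move: kN; rewrite !inE => /orP[/eqP ->|/andP[] //].
      by rewrite /d -nth_last.
    have := sorted_nth_leq ss kj (ltn_ord j); lia.
  have := leq_trans (subset_leq_card sub) (card_ord_geq n j.+1).
  rewrite cardsU1 iN; move: jQ dN; rewrite inE; have := ltn_ord j.
  by move: #|_| => a; rewrite -/n; lia.
move=> j jQ; rewrite addn0 ffunE lez_nat.
set C := [set _ | _].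
have sub : nbr F j [set k : 'I_n | (nth 0 s j <= nth 0 s k)%N]
    \subset nbr F j Q :|: C.
  apply/subsetP => k; rewrite !inE => /andP[sjk jkF]; rewrite jkF andbT.
  rewrite (setUC [set k]) jkF /=; case: (leqP (n - d)%N k.+1) => //= kM.
  move: (jQ) sjk (last_s k); rewrite inE sQ // => Mj sk ks.
  apply/and3P; split; last by rewrite eqn_leq sk ks.
    by rewrite /M ltn_subRL add1n.
  by rewrite -ltnS (leq_trans kM Mj).
have := leq_trans (lb j) (leq_trans (subset_leq_card sub) (leq_card_setU _ C)).
rewrite sQ // => le_d; rewrite -(leq_add2l #|nbr F j Q|); apply: leq_trans le_d.
by rewrite -ltnS -card_nbr_non_nbr.
Qed.

(** * Peeling a graph by shell index *)

Lemma core_vertices_anti (T : finType) (E : {set {set T}}) (i k : nat) (v : T) :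
  (i <= k)%N -> v \in (core E k).1 -> v \in (core E i).1.
Proof.
move=> ik; have dH : min_degree i (core E k).
  apply/forall_inP => w wk; apply: leq_trans ik _.
  exact: forall_inP (core_min_degree E k) w wk.
by have [/subsetP s _] := core_maximal (core_subgraph E k) dH; exact: s.
Qed.

Lemma mem_core_shell (T : finType) (E : {set {set T}}) (k : nat) (v : T) :
  (v \in (core E k).1) = (k <= shell_index E v)%N.
Proof.
have := shell_indexP E v (shell_index E v); rewrite eqxx => /andP[vi vi1].
apply/idP/idP => [vk|le_k]; last exact: core_vertices_anti vi.
by rewrite leqNgt; apply: contra vi1 => lt; apply: core_vertices_anti vk.
Qed.

(** The degree of [v] in its own core bounds its shell index. *)
Lemma shell_le_card_nbr (T : finType) (E : {set {set T}}) (v : T) :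
  simple_graph E ->
  (shell_index E v <=
     #|nbr E v [set w | (shell_index E v <= shell_index E w)%N]|)%N.
Proof.
move=> sE; set k := shell_index E v; have vk : v \in (core E k).1.
  by rewrite mem_core_shell.
apply: leq_trans (forall_inP (core_min_degree E k) v vk) _.
rewrite -card_edges_at ?inE //; apply: subset_leq_card.
have /andP[/subsetP sub /forall_inP inc] := core_subgraph E k.
apply/subsetP => e; rewrite !inE => /andP[eH ->]; rewrite sub //=.
by apply/subsetP => w we; rewrite inE -mem_core_shell (subsetP (inc e eH)).
Qed.

(** Among the vertices of least shell index in [A], one has at most that many
    neighbours in [A]. *)
Lemma ex_peelable (T : finType) (E : {set {set T}}) (A : {set T}) :
  simple_graph E -> A != set0 ->
  exists v, [/\ v \in A,
    forall w, w \in A -> (shell_index E v <= shell_index E w)%N &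
    (#|nbr E v A| <= shell_index E v)%N].
Proof.
move=> sE /set0Pn[x0 x0A]; pose sh := shell_index E.
have [u uA umin] := arg_minnP sh x0A; set k := sh u.
case: (boolP [exists v in A, (sh v == k) && (#|nbr E v A| <= k)%N]).
  case/exists_inP => v vA /andP[/eqP vk nv]; exists v; split=> //.
    by move=> w wA; rewrite -/(sh v) vk umin.
  by rewrite -/(sh v) vk.
rewrite negb_exists_in => /forall_inP h.
(* If every vertex of A of shell index k has more than k neighbours in A, then
   the graph induced on B has minimum degree above k. *)
pose B := A :|: (core E k.+1).1.
pose H := (B, [set e in E | e \subset B]).
have sH : subgraph E H.
  apply/andP; split; first by apply/subsetP => e; rewrite inE => /andP[].
  by apply/forall_inP => e; rewrite inE => /andP[].
have dH : min_degree k.+1 H.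
  apply/forall_inP => v vB; rewrite /degree /H /=.
  have -> : [set e in [set e in E | e \subset B] | v \in e] =
            [set e in E | (v \in e) && (e \subset B)].
    by apply/setP => e; rewrite !inE -andbA; congr (_ && _); rewrite andbC.
  have [vc|vc] := boolP (v \in (core E k.+1).1).
    apply: leq_trans (forall_inP (core_min_degree E k.+1) v vc) _.
    have /andP[/subsetP sub /forall_inP inc] := core_subgraph E k.+1.
    apply/subset_leq_card/subsetP => e; rewrite !inE => /andP[eH ->].
    by rewrite sub //= (subset_trans (inc e eH)) ?subsetUr.
  have vA : v \in A by move: vB; rewrite /= inE (negbTE vc) orbF.
  have vk : sh v == k.
    by rewrite eqn_leq umin // andbT leqNgt -mem_core_shell.
  rewrite card_edges_at //; have := h v vA; rewrite vk /= -ltnNge => lt.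
  exact: leq_trans lt (subset_leq_card (nbrS _ _ (subsetUl _ _))).
have [/subsetP sub _] := core_maximal sH dH.
have := sub u; rewrite /= inE (uA : u \in A) mem_core_shell -/(sh u) -/k ltnn.
by move=> /(_ isT).
Qed.

(** Removing peelable vertices one by one lists [A] by non-decreasing shell
    index, with few neighbours of each vertex after it. *)
Lemma ex_peeling_order (T : finType) (E : {set {set T}}) (A : {set T}) :
  simple_graph E ->
  exists l : seq T, [/\ uniq l, l =i A, sorted leq (map (shell_index E) l) &
    forall v, v \in A ->
      (#|nbr E v [set w in A | (index v l < index w l)%N]|
         <= shell_index E v)%N].
Proof.
move=> sE; have [m] := ubnP #|A|; elim: m A => // m IH A le_m.
have [->|nz] := eqVneq A set0.
  by exists [::]; split=> // v; rewrite inE.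
have [u [uA umin nu]] := ex_peelable sE nz.
have [|l [ul lA sl nl]] := IH (A :\ u).
  by move: le_m; rewrite (cardsD1 u) uA.
have ulN : u \notin l by rewrite lA !inE eqxx.
exists (u :: l); split=> /=.
- by rewrite ulN.
- by move=> w; rewrite inE lA !inE; case: eqVneq => // ->.
- rewrite path_min_sorted //; apply/allP => _ /mapP[w wl ->].
  by apply: umin; move: wl; rewrite lA => /setD1P[].
move=> v vA; rewrite eq_sym; case: eqVneq => [->|vu].
  apply: leq_trans nu; apply/subset_leq_card/nbrS/subsetP => w.
  by rewrite inE => /andP[].
apply: leq_trans (nl v _); last by rewrite !inE vu.
apply/subset_leq_card/nbrS/subsetP => w; rewrite !inE eq_sym.
by have [->|wu] := eqVneq w u; rewrite ?ltn0 ?andbF.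
Qed.

(** Neighbourhoods in the image of a graph under a bijection. *)
Lemma nbr_imset (T U : finType) (E : {set {set T}}) (f : T -> U) (g : U -> T)
    (v : T) (B : {set U}) :
  cancel f g -> cancel g f ->
  nbr [set f @: (e : {set T}) | e in E] (f v) B = f @: nbr E v (f @^-1: B).
Proof.
move=> fK gK; have f_inj := can_inj fK; apply/setP => y; rewrite -[y]gK.
rewrite (mem_imset _ _ f_inj) !inE; congr (_ && _).
have -> : [set f v; f (g y)] = f @: [set v; g y] by rewrite imsetU1 imset_set1.
by rewrite (mem_imset _ _ (imset_inj f_inj)).
Qed.

Theorem theorem9 (R : realFieldType) (T : finType) (E : {set {set T}})
    (hE : simple_graph E) (hT : (0 < #|T|)%N)
    (c : choices R (sorted_shell_sequence E)) :
  0 < prob (fun F => isomorphic E F) (graph_sampler c).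
Proof.
have [l [ul lT sl nl]] := ex_peeling_order setT hE.
have hs : sorted_shell_sequence E = map (shell_index E) l.
  apply: (sorted_eq leq_trans anti_leq) => //.
    exact: (sort_sorted leq_total).
  rewrite perm_sort; apply/perm_map/uniq_perm; rewrite ?enum_uniq //.
  by move=> x; rewrite mem_enum lT !inE.
have /card_gt0P[x0 _] := hT.
have sz : size (sorted_shell_sequence E) = size l by rewrite hs size_map.
have lt_f v : (index v l < size (sorted_shell_sequence E))%N.
  by rewrite sz index_mem lT inE.
pose f := [ffun v => Ordinal (lt_f v)].
pose g (y : 'I_(size (sorted_shell_sequence E))) := nth x0 l y.
have fK : cancel f g by move=> v; rewrite ffunE /g /= nth_index // lT inE.
have gK : cancel g f.
  by move=> y; apply: val_inj; rewrite ffunE /g /= index_uniq // -sz.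
have nth_f v : nth 0%N (sorted_shell_sequence E) (f v) = shell_index E v.
  rewrite ffunE /= hs (nth_map x0) ?index_mem ?lT ?inE //.
  by rewrite nth_index // lT inE.
apply: (@sampler_gt0 _ _ _ [set f @: (e : {set T}) | e in E]).
- apply/forall_inP => _ /imsetP[e eE ->]; rewrite card_imset.
    exact: (forall_inP hE).
  exact: can_inj fK.
- apply/existsP; exists f; rewrite eqxx andbT; apply/andP; split.
    by apply/injectiveP; exact: can_inj fK.
  by apply/forallP => y; apply/existsP; exists (g y); rewrite gK.
- exact: (sort_sorted leq_total).
- move=> i; rewrite -[i]gK nth_f (nbr_imset _ _ _ fK gK).
  rewrite card_imset; last exact: can_inj fK.
  apply: leq_trans (nl _ (in_setT _)); apply/subset_leq_card/nbrS/subsetP => w.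
  by rewrite !inE !ffunE.
move=> i; rewrite -[i]gK nth_f (nbr_imset _ _ _ fK gK).
rewrite card_imset; last exact: can_inj fK.
apply: leq_trans (shell_le_card_nbr _ hE) _.
apply/subset_leq_card/nbrS/subsetP => w.
by rewrite !inE nth_f.
Qed.
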